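(* Let $(\Gamma_m)_{m\in\mathbb{N}}$ and $(\Lambda_n)_{n\in\mathbb{N}}$ be two sequences of connected graphs of uniformly bounded degree. Let $X_1=\bigsqcup_{m\in\mathbb{N}}\Gamma_m$ and $X_2=\bigsqcup_{n\in\mathbb{N}}\Lambda_n$. Endow $X_1\times X_2$ with the structure of a disjoint union $$X_1\times X_2=\bigsqcup_{m,n\in\mathbb{N}}(\Gamma_m\times\Lambda_n),$$ where $\Gamma_m\times\Lambda_n$ is equipped with the $\ell_1$-metric from $d_{\Gamma_m}$ and $d_{\Lambda_n}$. Let $\mathcal{M}$ be a non-empty class of metric spaces such that $\mathcal{UP}(\mathcal{M})\subseteq\mathcal{M}$. Then $X_1\times X_2$ admits a fibred coarse embedding as a disjoint union into $\mathcal{M}$ only if $X_1$ and $X_2$ both admit (genuine) coarse embeddings into $\mathcal{M}$. In particular, this assertion applies to the case where $\mathcal{M}=\mathcal{H}\mathrm{ilbert}$, the class of all Hilbert spaces.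
   Context: Graphs are regarded as their vertex sets with the shortest path metric. The disjoint union of metric spaces carries the generalized metric equal to the given one on each component and $+\infty$ between different components. Isometries (of a space onto a space) are surjective. **Coarse embedding.** A generalized metric space $(X,d)$ admits a coarse embedding into $\mathcal{M}$ if there are $M\in\mathcal{M}$, a map $f:X\to M$, and non-decreasing $\rho,\omega:[0,\infty)\to[0,\infty)$ tending to $+\infty$ at $+\infty$, with $\rho(d(x_1,x_2))\le d_M(f(x_1),f(x_2))\le\omega(d(x_1,x_2))$ for all $x_1,x_2\in X$ with $d(x_1,x_2)<+\infty$. **Fibred coarse embeddings.** Let $X$ be the disjoint union of a countably infinite family of metric spaces, enumerated as $(X_l)_{l\in\mathbb{N}}$ (the notion below does not depend on the enumeration), that is equi-uniformly locally finite (for every $R$, closed $R$-balls have cardinality bounded by a constant independent of center and $l$). $X$ admits a fibred coarse embedding into $\mathcal{M}$ as a disjoint union if there are $M\in\mathcal{M}$, non-decreasing $\rho,\omega:[0,\infty)\to[0,\infty)$ tending to $+\infty$ at $+\infty$, a field $(M_x)_{x\in X}$ of metric spaces each isometric to $M$, and a section $s$ with $s(x)\in M_x$, such that for every $R\ge0$ there is $l^{(R)}\in\mathbb{N}_{\ge1}$ such that each non-empty $C\subseteq X\setminus\bigsqcup_{l<l^{(R)}}X_l$ of diameter at most $R$ has a trivialization $t_{C,R}$, i.e. isometries $t_{C,R}(x):M_x\to M$ ($x\in C$), with (1) $\rho(d(x_1,x_2))\le d_M(t_{C,R}(x_1)(s(x_1)),t_{C,R}(x_2)(s(x_2)))\le\omega(d(x_1,x_2))$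 for all $x_1,x_2\in C$; (2) for any two such $C_1,C_2$ with $C_1\cap C_2\neq\emptyset$ there is an isometry $t_{C_1,C_2,R}:M\to M$ with $t_{C_1,R}(x)\circ t_{C_2,R}(x)^{-1}=t_{C_1,C_2,R}$ for all $x\in C_1\cap C_2$. (Trivializations for different $R$ need not be compatible; if $\mathcal{M}$ consists of Banach spaces, these isometries are assumed affine.) **$\mathcal{UP}(\mathcal{M})$.** For a non-principal ultrafilter $\mathcal{U}$ on $\mathbb{N}$ and pointed metric spaces $(M_m,d_m,y_m)$, $\lim_{\mathcal{U}}(M_m,y_m)$ is the quotient of $\{(z_m)_m:\sup_md_m(z_m,y_m)<\infty\}$ by the pseudometric $\lim_{\mathcal{U}}d_m(z_m,w_m)$, with the induced metric. $\mathcal{UP}(\mathcal{M})$ is the class of all metric spaces isometric to some $\lim_{\mathcal{U}}(M,y_m)$ with a single $M\in\mathcal{M}$, $y_m\in M$ for each $m$, and $\mathcal{U}$ any non-principal ultrafilter on $\mathbb{N}$.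
   Formalization: For a general class M of metric spaces with some infinite graphs, one common target is claimed only if isometry groups of all members of M act coboundedly; otherwise each component embeds in some member of M with common ρ, ω (the literal claim fails). Banach and Hilbert cases are unrestricted. *)

(* Defs.v *)
From HB Require Import structures.
From mathcomp Require Import all_boot all_order all_algebra sesquilinear.
From mathcomp Require Import all_classical all_reals all_analysis.

Set Implicit Arguments.
Unset Strict Implicit.
Unset Printing Implicit Defensive.

Import Order.TTheory GRing.Theory Num.Theory.
Import numFieldNormedType.Exports.

Local Open Scope classical_set_scope.
Local Open Scope card_scope.
Local Open Scope quotient_scope.
Local Open Scope ring_scope.

Record connected_graph := ConnectedGraph {
  vertex :> choiceType ;
  adj : rel vertex ;
  adj_sym : symmetric adj ;
  adj_irr : irreflexive adj ;
  vertex_nonempty : inhabited vertex ;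
  adj_connected : forall x y, exists p, path adj x p /\ last x p = y }.

Definition uniformly_bounded_degree (G : nat -> connected_graph) : Prop :=
  exists D, forall m (v : G m), [set w | adj v w] #<= `I_D.

Definition walk_length (G : connected_graph) (x y : G) (n : nat) : bool :=
  `[< exists p, [/\ path (@adj G) x p, last x p = y & size p = n] >].

Lemma walk_exists (G : connected_graph) (x y : G) :
  exists n, walk_length x y n.
Proof.
by have [p [xp py]] := adj_connected x y; exists (size p); apply/asboolP; exists p.
Qed.

Definition graph_dist (G : connected_graph) (x y : G) : nat :=
  ex_minn (walk_exists x y).

Lemma graph_dist_min (G : connected_graph) (x y : G) p :
  path (@adj G) x p -> last x p = y -> (graph_dist x y <= size p)%N.
Proof.
move=> xp py; rewrite /graph_dist; case: ex_minnP => n _; apply.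
by apply/asboolP; exists p.
Qed.

Lemma graph_distP (G : connected_graph) (x y : G) :
  exists p, [/\ path (@adj G) x p, last x p = y & size p = graph_dist x y].
Proof. by rewrite /graph_dist; case: ex_minnP => n /asboolP. Qed.

Lemma graph_distxx (G : connected_graph) (x : G) : graph_dist x x = 0%N.
Proof. by apply/eqP; rewrite -leqn0; exact: (@graph_dist_min _ x x [::]). Qed.

Lemma graph_dist_eq0 (G : connected_graph) (x y : G) :
  graph_dist x y = 0%N -> x = y.
Proof. by have [[|z p] [_ <- <-]] := graph_distP x y. Qed.

Lemma graph_dist_sym_le (G : connected_graph) (x y : G) :
  (graph_dist y x <= graph_dist x y)%N.
Proof.
have [p [xp py <-]] := graph_distP x y.
rewrite -(size_belast x p) -size_rev -{1}py; apply: graph_dist_min.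
  by rewrite rev_path (eq_path (e' := @adj G)) // => u v; exact: adj_sym.
by case: p {xp py} => //= z p; rewrite rev_cons last_rcons.
Qed.

Lemma graph_distC (G : connected_graph) (x y : G) :
  graph_dist x y = graph_dist y x.
Proof. by apply/eqP; rewrite eqn_leq !graph_dist_sym_le. Qed.

Lemma graph_dist_triangle (G : connected_graph) (y x z : G) :
  (graph_dist x z <= graph_dist x y + graph_dist y z)%N.
Proof.
have [p [xp py <-]] := graph_distP x y; have [q [yq qz <-]] := graph_distP y z.
rewrite -size_cat; apply: graph_dist_min; first by rewrite cat_path xp py yq.
by rewrite last_cat py.
Qed.

(* The vertex set with the shortest path metric. *)
Definition graph_space (R : realType) (G : connected_graph) : Type := vertex G.

Section GraphSpace.
Context (R : realType) (G : connected_graph).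
Let d (x y : graph_space R G) : R := (graph_dist (x : G) y)%:R.

Let dxx x : d x x = 0. Proof. by rewrite /d graph_distxx. Qed.
Let d_eq0 x y : d x y = 0 -> x = y.
Proof. by move/eqP; rewrite pnatr_eq0 => /eqP/graph_dist_eq0. Qed.
Let d_sym x y : d x y = d y x. Proof. by rewrite /d graph_distC. Qed.
Let d_triangle y x z : d x z <= d x y + d y z.
Proof. by rewrite /d -natrD ler_nat graph_dist_triangle. Qed.

HB.instance Definition _ := Choice.on (graph_space R G).
HB.instance Definition _ := @isMetric.Build R (graph_space R G) d dxx d_eq0 d_sym d_triangle.
End GraphSpace.

Definition graph_metric (R : realType) (G : connected_graph) : metricType R :=
  graph_space R G.

Definition l1_prod (R : realType) (A B : metricType R) : Type := (A * B)%type.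

Section L1Prod.
Context (R : realType) (A B : metricType R).
Let d (x y : l1_prod A B) : R := mdist x.1 y.1 + mdist x.2 y.2.

Let dxx x : d x x = 0. Proof. by rewrite /d !mdistxx addr0. Qed.
Let d_eq0 x y : d x y = 0 -> x = y.
Proof.
move/eqP; rewrite paddr_eq0 ?mdist_ge0// => /andP[/eqP e1 /eqP e2].
by case: x y e1 e2 => [x1 x2] [y1 y2] /= /mdist_positivity -> /mdist_positivity ->.
Qed.
Let d_sym x y : d x y = d y x.
Proof. by rewrite /d (metric_sym x.1) (metric_sym x.2). Qed.
Let d_triangle y x z : d x z <= d x y + d y z.
Proof. by rewrite /d addrACA lerD// metric_triangle. Qed.

HB.instance Definition _ := Choice.on (l1_prod A B).
HB.instance Definition _ := @isMetric.Build R (l1_prod A B) d dxx d_eq0 d_sym d_triangle.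
End L1Prod.

Definition l1_metric (R : realType) (A B : metricType R) : metricType R :=
  l1_prod A B.

(* A Banach space as a metric space, with d(x, y) = |x - y|. *)
Definition norm_space (R : realType) (V : completeNormedModType R) : Type := V.

Section NormSpace.
Context (R : realType) (V : completeNormedModType R).
Let d (x y : norm_space V) : R := `|(x : V) - y|.

Let dxx x : d x x = 0. Proof. by rewrite /d subrr normr0. Qed.
Let d_eq0 x y : d x y = 0 -> x = y.
Proof. by move/normr0_eq0/subr0_eq. Qed.
Let d_sym x y : d x y = d y x. Proof. by rewrite /d distrC. Qed.
Let d_triangle y x z : d x z <= d x y + d y z.
Proof. exact: ler_distD. Qed.

HB.instance Definition _ := Choice.on (norm_space V).
HB.instance Definition _ := @isMetric.Build R (norm_space V) d dxx d_eq0 d_sym d_triangle.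
End NormSpace.

Definition norm_metric (R : realType) (V : completeNormedModType R) :
    metricType R := norm_space V.

Definition isometry_onto (R : realType) (A B : metricType R) (f : A -> B) : Prop :=
  (forall x y, mdist (f x) (f y) = mdist x y) /\ (forall z, exists x, f x = z).

Definition isometric (R : realType) (A B : metricType R) : Prop :=
  exists f : A -> B, isometry_onto f.

Definition affine_isometry (R : realType) (V W : completeNormedModType R)
    (f : norm_metric V -> norm_metric W) : Prop :=
  isometry_onto f /\
  forall (a : R) (x y : V),
    f (a *: x + (1 - a) *: y) = a *: (f x : W) + (1 - a) *: (f y : W) :> W.

(* Disjoint unions, as a generalized metric on {i : I & X i}. *)
Definition du_dist (R : realType) (I : eqType) (X : I -> metricType R)
    (x y : {i : I & X i}) : \bar R :=
  if tag x == tag y then (mdist (tagged x) (tagged_as x y))%:E else +oo%E.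

Definition du_diam (R : realType) (I : eqType) (X : I -> metricType R)
    (C : set {i : I & X i}) : \bar R :=
  ereal_sup [set du_dist p.1 p.2 | p in C `*` C].

Definition control_function (R : realType) (rho : R -> R) : Prop :=
  [/\ {in `[0, +oo[ &, {homo rho : s t / s <= t}},
      {in `[0, +oo[, forall t, 0 <= rho t} &
      rho t @[t --> +oo] --> +oo].

(* [set T] lives in too small a universe to range over all metric spaces. *)
Definition spaceclass (T : Type) := T -> Prop.

Definition coarse_embedding_into (R : realType) (M : spaceclass (metricType R))
    (X : Type) (d : X -> X -> \bar R) : Prop :=
  exists A, M A /\ exists (f : X -> A) (rho omega : R -> R),
    [/\ control_function rho, control_function omega &
      forall x1 x2, (d x1 x2 < +oo)%E ->
        rho (fine (d x1 x2)) <= mdist (f x1) (f x2) <= omega (fine (d x1 x2))].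

(* Every component embeds into some member of M, with the same control
   functions for all components; the member may depend on the component. *)
Definition componentwise_coarse_embedding_into (R : realType)
    (M : spaceclass (metricType R)) (I : Type) (X : I -> metricType R) : Prop :=
  exists rho omega : R -> R,
    [/\ control_function rho, control_function omega &
      forall i, exists A, M A /\ exists f : X i -> A, forall x1 x2,
        rho (mdist x1 x2) <= mdist (f x1) (f x2) <= omega (mdist x1 x2)].

(* The isometry group acts with bounded distance between orbits. *)
Definition cobounded (R : realType) (A : metricType R) : Prop :=
  exists b : R, forall p q : A, exists g : A -> A,
    isometry_onto g /\ mdist (g p) q <= b.

(* A sufficient condition under which the targets of the components of the
   disjoint union of G can be merged into one.  Without it they cannot, even
   for classes closed under ultrapowers: infinite components give rise to
   ultralimits of one space along base points that drift apart. *)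
Definition mergeable (R : realType) (M : spaceclass (metricType R))
    (G : nat -> connected_graph) : Prop :=
  (forall m, finite_set [set: G m]) \/ (forall A, M A -> cobounded A).

Definition nonempty_class (T : Type) (M : spaceclass T) : Prop := exists A, M A.

Definition subclass (T : Type) (M N : spaceclass T) : Prop :=
  forall A, M A -> N A.

Definition equi_uniformly_locally_finite (R : realType) (I : Type)
    (X : I -> metricType R) : Prop :=
  forall r : R, exists N, forall i (x : X i), [set y | mdist x y <= r] #<= `I_N.

(* The targets are objects of type S with underlying metric space u; iso A B
   is the class of isometries that trivializations and their transition maps
   are required to belong to. *)
Definition fibred_coarse_embedding_with (R : realType) (S : Type)
    (u : S -> metricType R) (iso : forall A B, (u A -> u B) -> Prop)
    (M : spaceclass S) (I : eqType) (X : I -> metricType R) : Prop :=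
  equi_uniformly_locally_finite X /\
  exists enum : nat -> I, bijective enum /\
  exists A, M A /\ exists rho omega : R -> R,
    [/\ control_function rho, control_function omega &
  exists (F : {i : I & X i} -> S) (s : forall x, u (F x)),
    (forall x, exists f, iso (F x) A f) /\
    forall r : R, 0 <= r -> exists l, (1 <= l)%N /\
      let small (C : set {i : I & X i}) :=
        [/\ C !=set0, (forall x k, C x -> (k < l)%N -> tag x != enum k) &
            (du_diam C <= r%:E)%E] in
      exists t : set {i : I & X i} -> forall x, u (F x) -> u A,
        (forall C, small C ->
          (forall x, C x -> iso (F x) A (t C x)) /\
          (forall x1 x2, C x1 -> C x2 ->
            rho (fine (du_dist x1 x2))
              <= mdist (t C x1 (s x1)) (t C x2 (s x2))
              <= omega (fine (du_dist x1 x2)))) /\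
        (forall C1 C2, small C1 -> small C2 -> C1 `&` C2 !=set0 ->
          exists tau, iso A A tau /\
            forall x, (C1 `&` C2) x -> t C1 x = tau \o t C2 x)].

Definition fibred_coarse_embedding_into (R : realType)
    (M : spaceclass (metricType R)) (I : eqType) (X : I -> metricType R) : Prop :=
  fibred_coarse_embedding_with (u := id) (@isometry_onto R) M X.

Definition affine_fibred_coarse_embedding_into (R : realType)
    (B : spaceclass (completeNormedModType R)) (I : eqType) (X : I -> metricType R) :
    Prop :=
  fibred_coarse_embedding_with (u := @norm_metric R)
    (@affine_isometry R) B X.

Record ultrafilter := Ultrafilter {
  ultra_sets :> set_system nat ;
  ultra_ultra : UltraFilter ultra_sets ;
  ultra_nonprincipal : forall n, ~ ultra_sets [set n] }.

#[global] Instance ultrafilter_proper (U : ultrafilter) :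
  ProperFilter (ultra_sets U) := @ultra_proper _ _ (ultra_ultra U).

Section Ultralimit.
Context (R : realType) (U : ultrafilter) (M : nat -> metricType R).
Context (y : forall m, M m).

Record bounded_seq := BoundedSeq {
  bseq_val :> forall m, M m ;
  bseqP : exists b, forall m, mdist (bseq_val m) (y m) <= b }.

HB.instance Definition _ := gen_eqMixin bounded_seq.
HB.instance Definition _ := gen_choiceMixin bounded_seq.

Definition ultra_dist (z w : bounded_seq) : R :=
  lim (mdist (z m) (w m) @[m --> ultra_sets U]).

Lemma ultra_dist_cvg (z w : bounded_seq) :
  mdist (z m) (w m) @[m --> ultra_sets U] --> ultra_dist z w.
Proof.
have [b zb] := bseqP z; have [c wc] := bseqP w.
pose g m : R := mdist (z m) (w m).
have gb m : `[0, b + c]%classic (g m).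
  rewrite /= in_itv /= mdist_ge0 /=; apply: (le_trans (metric_triangle _ (y m) _)).
  by rewrite lerD// metric_sym.
have fU : UltraFilter (g @ ultra_sets U).
  have UF : UltraFilter (ultra_sets U) by exact: ultra_ultra.
  split; first exact: fmap_proper_filter.
  move=> G GF gG; apply/seteqP; split => // A GA.
  have [//|UA] := in_ultra_setVsetC (g @^-1` A) UF.
  have GC : G (~` A) by apply: gG.
  by have [v []] := @filter_ex _ _ GF _ (filterI GA GC).
have := @segment_compact R 0 (b + c); rewrite compact_ultra => /(_ _ fU).
case; first exact: (filterE _ gb).
move=> p [_ /= gp]; rewrite /ultra_dist.
have -> : lim (g @ ultra_sets U) = p by exact: (cvg_lim (@Rhausdorff R) gp).
  exact: gp.
Qed.

Lemma ultra_dist_xx z : ultra_dist z z = 0.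
Proof.
have E : (fun m => mdist (z m) (z m)) = cst (0 : R).
  by apply/funext => m; rewrite mdistxx.
by rewrite /ultra_dist E lim_cst.
Qed.

Lemma ultra_distC z w : ultra_dist z w = ultra_dist w z.
Proof.
have E : (fun m => mdist (z m) (w m)) = (fun m => mdist (w m) (z m)).
  by apply/funext => m; exact: metric_sym.
by rewrite /ultra_dist E.
Qed.

Lemma ultra_dist_ge0 z w : 0 <= ultra_dist z w.
Proof.
apply: (cvgr_to_ge (@ultra_dist_cvg z w)).
by apply: filterE => m; exact: mdist_ge0.
Qed.

Lemma ultra_dist_triangle w z v :
  ultra_dist z v <= ultra_dist z w + ultra_dist w v.
Proof.
apply: (ler_cvg_to (@ultra_dist_cvg z v)
  (cvgD (@ultra_dist_cvg z w) (@ultra_dist_cvg w v))).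
by apply: filterE => m; exact: metric_triangle.
Qed.

Definition ultra_eq (z w : bounded_seq) : bool := ultra_dist z w == 0.

Lemma ultra_eq_refl : reflexive ultra_eq.
Proof. by move=> z; rewrite /ultra_eq ultra_dist_xx. Qed.

Lemma ultra_eq_sym : symmetric ultra_eq.
Proof. by move=> z w; rewrite /ultra_eq ultra_distC. Qed.

Lemma ultra_eq_trans : transitive ultra_eq.
Proof.
move=> w z v /eqP zw /eqP wv; rewrite /ultra_eq eq_le ultra_dist_ge0 andbT.
by rewrite (le_trans (ultra_dist_triangle w z v))// zw wv addr0.
Qed.

Canonical ultra_equiv :=
  EquivRel ultra_eq ultra_eq_refl ultra_eq_sym ultra_eq_trans.

Definition ultralimit : Type := {eq_quot ultra_equiv}.

HB.instance Definition _ := Choice.on ultralimit.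

Definition ultralimit_class (z : bounded_seq) : ultralimit :=
  (\pi_{eq_quot ultra_equiv} z).

Let d (p q : ultralimit) : R :=
  ultra_dist (repr (p : {eq_quot ultra_equiv})) (repr (q : {eq_quot ultra_equiv})).

Let dxx p : d p p = 0. Proof. exact: ultra_dist_xx. Qed.
Let d_eq0 p q : d p q = 0 -> p = q.
Proof.
move=> /eqP pq; rewrite -[p](@reprK _ {eq_quot ultra_equiv}).
by rewrite -[q](@reprK _ {eq_quot ultra_equiv}); apply/eqmodP.
Qed.
Let d_sym p q : d p q = d q p. Proof. exact: ultra_distC. Qed.
Let d_triangle q p r : d p r <= d p q + d q r.
Proof. exact: ultra_dist_triangle. Qed.

HB.instance Definition _ :=
  @isMetric.Build R ultralimit d dxx d_eq0 d_sym d_triangle.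

Lemma mdist_ultralimit (z w : bounded_seq) :
  mdist (ultralimit_class z) (ultralimit_class w) = ultra_dist z w.
Proof.
have E v : ultra_dist (repr (\pi_{eq_quot ultra_equiv} v)) v = 0.
  by apply/eqP/(@eqmodP _ ultra_equiv); rewrite reprK.
have le_rep a b a' b' : ultra_dist a a' = 0 -> ultra_dist b b' = 0 ->
    ultra_dist a b <= ultra_dist a' b'.
  move=> aa bb; apply: (le_trans (ultra_dist_triangle a' _ _)).
  rewrite aa add0r (le_trans (ultra_dist_triangle b' _ _))//.
  by rewrite (ultra_distC b') bb addr0.
by apply/eqP; rewrite eq_le; apply/andP; split; apply: le_rep;
  rewrite ?E// ultra_distC E.
Qed.

End Ultralimit.

(* The class UP(M). *)
Definition ultrapowers (R : realType) (M : spaceclass (metricType R)) :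
    spaceclass (metricType R) :=
  fun N => exists (A : metricType R) (U : ultrafilter) (y : nat -> A),
    M A /\ isometric N (ultralimit U y).

Definition underlying_metric (R : realType) (B : spaceclass (completeNormedModType R)) :
    spaceclass (metricType R) :=
  fun N => exists V, B V /\ isometric N (norm_metric V).

Definition hilbert_space (R : realType) : spaceclass (completeNormedModType R) :=
  fun V => exists b : {dot V for @idfun R}, forall x : V, `|x| ^+ 2 = b x x.

(* Main.v *)
From HB Require Import structures.
Require Import Defs.
From mathcomp Require Import all_boot all_order all_algebra sesquilinear.
From mathcomp Require Import all_classical all_reals all_analysis.
From mathcomp Require Import lra ring.

Set Implicit Arguments.
Unset Strict Implicit.
Unset Printing Implicit Defensive.

Import Order.TTheory GRing.Theory Num.Theory.
Import numFieldNormedType.Exports.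

Local Open Scope classical_set_scope.
Local Open Scope quotient_scope.
Local Open Scope ring_scope.

(** Every factor occurs in infinitely many products, so at each scale some copy
of it lies where the fibred embedding has trivializations. Fix [m] and a scale
[r]. All but finitely many of the products [X1 m * X2 n] lie beyond the
threshold attached to [r], so for some [n] a set of diameter at most [r] in the
slice [X1 m * {p}], an isometric copy of [X1 m], has a trivialization. Composed
with the section it is a map into the model space [A] with the given controls
[rho] and [omega], which do not depend on [m] or [r]
([fibred_far_bounded_sets_embed], [slices_embed]). Thus bounded subsets of the
factors embed into [A] uniformly.

Maps [f_k] on the balls of radius [k] about a base point [x0] pass to the
ultralimit: [x] goes to the class of [f_k x], taken along base points that
stay at bounded distance from [f_k x0], and both control inequalities survive
the limit ([ultralimit_controlled]). With base points [f_k x0] this embeds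
each component into an ultrapower of [A], which may vary with the component.
One target serves all components when isometries of [A] bring every [f_k x0]
close to one point, so that the base points can be constant
([coarse_embedding_cobounded]), and when the components are finite, since then
no limit is taken ([coarse_embedding_finite]). Translations make Banach spaces
cobounded.

For Hilbert spaces, closure under ultrapowers remains to be shown. After
moving the base points to [0] by translations, the ultrapower of [V] is the
space of bounded sequences modulo null sequences along the ultrafilter: it is a
normed space, complete by a diagonal argument ([ultralimit_complete]), and the
inner product passes to the limit because the polarization identity expresses
it through norms ([polar_form_cvg]). *)

(** * Ultrafilters and ultralimits *)

Lemma ultrafilter_tail (U : ultrafilter) (N : nat) :
  \forall m \near ultra_sets U, (N <= m)%N.
Proof.
elim: N => [|N IH]; first exact: filterE.
have UF : UltraFilter (ultra_sets U) := ultra_ultra U.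
have [/(@ultra_nonprincipal U)//|UN] := in_ultra_setVsetC [set N] UF.
apply: filterS2 IH UN => m Nm /= mN.
by rewrite ltn_neqAle Nm andbT; apply/eqP => eN; apply: mN.
Qed.

Lemma ultrafilter_exists : inhabited ultrafilter.
Proof.
have [G [GU sG]] := ultraFilterLemma (F := \oo) _.
split; apply: (@Ultrafilter G GU) => n Gn.
have Gs : G [set m | (n < m)%N] by apply: sG; exact: nbhs_infty_gt.
by have [m [/= -> ]] := filter_ex (filterI Gn Gs); rewrite ltnn.
Qed.

Lemma ultra_cvg_unique (R : realType) (U : ultrafilter) (f : nat -> R)
    (a b : R) :
  f m @[m --> ultra_sets U] --> a -> f m @[m --> ultra_sets U] --> b -> a = b.
Proof. by apply: cvg_unique; exact: Rhausdorff. Qed.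

Lemma choice_forall (I : Type) (X : I -> Type) (P : forall i, X i -> Prop) :
  (forall i, exists x, P i x) -> exists f : forall i, X i, forall i, P i (f i).
Proof.
move=> h; exists (fun i => projT1 (cid (h i))) => i.
exact: (projT2 (cid (h i))).
Qed.

Lemma inhabited_forall (I : Type) (X : I -> Type) :
  (forall i, inhabited (X i)) -> inhabited (forall i, X i).
Proof.
move=> X0; have h i : exists x : X i, True by have [x] := X0 i; exists x.
by have [f _] := choice_forall h; exists.
Qed.

Lemma isometric_refl (R : realType) (A : metricType R) : isometric A A.
Proof. by exists idfun; split=> // z; exists z. Qed.

Lemma isometric_trans (R : realType) (A B C : metricType R) :
  isometric A B -> isometric B C -> isometric A C.
Proof.
move=> [f [fd fs]] [g [gd gs]]; exists (g \o f); split=> [x y|z].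
  by rewrite /= gd fd.
by have [y <-] := gs z; have [x <-] := fs y; exists x.
Qed.

Section UltraDist.
Context (R : realType) (U : ultrafilter) (M : nat -> metricType R).
Context (y : forall m, M m) (z w : bounded_seq y) (a : R).

Lemma ultra_dist_ge :
  (\forall m \near ultra_sets U, a <= mdist (z m) (w m)) -> a <= ultra_dist U z w.
Proof. by move=> h; apply: (cvgr_to_ge (@ultra_dist_cvg _ U _ _ z w)). Qed.

Lemma ultra_dist_le :
  (\forall m \near ultra_sets U, mdist (z m) (w m) <= a) -> ultra_dist U z w <= a.
Proof. by move=> h; apply: (cvgr_to_le (@ultra_dist_cvg _ U _ _ z w)). Qed.

End UltraDist.

Section UltralimitTheory.
Context (R : realType) (U : ultrafilter) (M : nat -> metricType R).
Context (y : forall m, M m).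

Lemma ultralimit_surj (p : ultralimit U y) : exists z, p = ultralimit_class U z.
Proof.
exists (repr (p : {eq_quot ultra_equiv U y})).
by rewrite /ultralimit_class reprK.
Qed.

Lemma ultralimit_class_eq (z w : bounded_seq y) :
  (forall m, z m = w m) -> ultralimit_class U z = ultralimit_class U w.
Proof.
move=> zw; apply: mdist_positivity; rewrite mdist_ultralimit.
apply/eqP; rewrite eq_le ultra_dist_ge0 andbT; apply: ultra_dist_le.
by apply: filterE => m; rewrite zw mdistxx.
Qed.

(** Completeness comes from the countable incompleteness of a nonprincipal
ultrafilter on the integers. Choose centres [p k] of balls of radius
[1 / (k + 1)] that belong to the Cauchy filter, with representing sequences
[z k]. The limit is represented by the diagonal sequence [m |-> z (n m) m],
where [n m <= m] is the last index [k] for which [z k m] is closer than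
[1 / (i + 1) + 1 / (k + 1)] to [z i m] for every [i <= k]. *)
Lemma ultralimit_complete (F : set_system (ultralimit U y)) :
  ProperFilter F -> cauchy F -> exists p : ultralimit U y, F --> p.
Proof.
move=> FF /cauchyP Fc; pose e (k : nat) : R := k.+1%:R^-1.
have e0 k : 0 < e k by rewrite invr_gt0 ltr0n.
have e_le i j : (i <= j)%N -> e j <= e i.
  by move=> ij; rewrite lef_pV2 ?posrE ?ltr0n// ler_nat.
have [p Fp] := choice_forall (fun k => Fc (e k) (e0 k)).
have [z zp] := choice_forall (fun k => ultralimit_surj (p k)).
have z_near i j : ultra_dist U (z i) (z j) < e i + e j.
  rewrite -mdist_ultralimit -!zp.
  have [x []] := filter_ex (filterI (Fp i) (Fp j)).
  rewrite !ballEmdist /= => ix jx.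
  by rewrite (le_lt_trans (metric_triangle _ x _))// ltrD// metric_sym.
pose good k m := (k <= m)%N /\
  forall i : 'I_k.+1, mdist (z i m) (z k m) < e i + e k.
have Ugood k : \forall m \near ultra_sets U, good k m.
  have near_k : \forall m \near ultra_sets U,
      forall i : 'I_k.+1, mdist (z i m) (z k m) < e i + e k.
    apply: (@filter_forall _ 'I_k.+1 (fun i m => is_true (_ < e i + e k)) _
      (@filter_filter _ _ (ultrafilter_proper U))) => i.
    exact: (cvgr_lt _ (@ultra_dist_cvg _ U _ _ (z i) (z k))).
  exact: filterI (ultrafilter_tail U k) near_k.
(* Index 0 is always good and good indices are at most m, so a largest one
   exists; as every k is good for almost all m, n m tends to infinity along U. *)
have [n nP] : exists n : nat -> nat, forall m, good (n m) m /\
    forall i, good i m -> (i <= n m)%N.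
  suff ex_n m : exists n, good n m /\ forall i, good i m -> (i <= n)%N.
    by have [n nP] := choice_forall ex_n; exists n.
  pose P k := `[< good k m >].
  have P0 : exists k, P k.
    exists 0%N; apply/asboolP; split=> // i.
    by rewrite (ord1 i) mdistxx addr_gt0.
  have Pm k : P k -> (k <= m)%N by move=> /asboolP[].
  case: (ex_maxnP P0 Pm) => k /asboolP gk maxk; exists k; split=> // i gi.
  by apply: maxk; apply/asboolP.
have close i m : (i <= n m)%N -> mdist (z i m) (z (n m) m) <= e i + e i.
  move=> inm; have [[_ zn] _] := nP m.
  have {zn} := zn (Ordinal (inm : (i < (n m).+1)%N)) => /ltW /= zn.
  by rewrite (le_trans zn)// lerD2l e_le.
have wb : exists b, forall m, mdist (z (n m) m) (y m) <= b.
  have [b zb] := bseqP (z 0%N); exists (e 0%N + e 0%N + b) => m.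
  rewrite (le_trans (metric_triangle _ (z 0%N m) _))// lerD// metric_sym.
  exact: close.
exists (ultralimit_class U (BoundedSeq wb)); apply/fcvg_ballP => eps eps0.
have [i _ /(_ i) /= ei] :=
  near_infty_natSinv_lt (PosNum (divr_gt0 eps0 (ltr0n R 3))).
have {}ei : e i < eps / 3%:R by apply: ei.
apply: filterS (Fp i) => x; rewrite !ballEmdist /= => ix.
(* The limit is at most 2 e i away from p i, which is less than e i from x. *)
have wp : mdist (ultralimit_class U (BoundedSeq wb)) (p i) <= e i + e i.
  rewrite metric_sym zp mdist_ultralimit; apply: ultra_dist_le.
  by apply: filterS (Ugood i) => m gi /=; apply: close; have [_] := nP m; apply.
rewrite (le_lt_trans (metric_triangle _ (p i) _))//.
rewrite (lt_le_trans (ler_ltD wp ix))//.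
have -> : eps = eps / 3%:R + eps / 3%:R + eps / 3%:R.
  by lra.
by rewrite !lerD// ltW.
Qed.

End UltralimitTheory.

Lemma eq_ultra_dist (R : realType) (U : ultrafilter) (A B : nat -> metricType R)
    (a : forall m, A m) (b : forall m, B m) (z w : bounded_seq a)
    (z' w' : bounded_seq b) :
  (forall m, mdist (z m) (w m) = mdist (z' m) (w' m)) ->
  ultra_dist U z w = ultra_dist U z' w'.
Proof. by move=> zw; rewrite /ultra_dist (funext zw). Qed.

Lemma ultralimit_isometric (R : realType) (U : ultrafilter)
    (A B : nat -> metricType R) (a : forall m, A m) (h : forall m, A m -> B m) :
  (forall m, isometry_onto (h m)) ->
  isometric (ultralimit U a) (ultralimit U (fun m => h m (a m))).
Proof.
move=> hiso; have hd m x x' : mdist (h m x) (h m x') = mdist x x'.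
  by have [] := hiso m.
have hb (z : bounded_seq a) : exists b, forall m, mdist (h m (z m)) (h m (a m)) <= b.
  by have [b zb] := bseqP z; exists b => m; rewrite hd.
have [rep repP] := choice_forall (@ultralimit_surj _ U _ a).
exists (fun p => ultralimit_class U (BoundedSeq (hb (rep p)))); split=> [p q|q].
  rewrite [in RHS](repP p) [in RHS](repP q) !mdist_ultralimit.
  by apply: eq_ultra_dist => m /=; rewrite hd.
have [w ->] := ultralimit_surj q.
have [z zP] : exists z : forall m, A m, forall m, h m (z m) = w m.
  suff ex_z m : exists x, h m x = w m by exact: choice_forall ex_z.
  by have [_ h_onto] := hiso m; exact: h_onto.
have zb : exists b, forall m, mdist (z m) (a m) <= b.
  by have [b wb] := bseqP w; exists b => m; rewrite -hd zP.
exists (ultralimit_class U (BoundedSeq zb)).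
apply: mdist_positivity; rewrite mdist_ultralimit.
have := mdist_ultralimit U (rep (ultralimit_class U (BoundedSeq zb))) (BoundedSeq zb).
rewrite -repP mdistxx => /esym <-.
by apply: eq_ultra_dist => m /=; rewrite -zP hd.
Qed.

(** * Ultralimits of partial embeddings *)

Section Metric.
Context {R : realType}.
Implicit Types (A B X : metricType R) (rho omega : R -> R).

Definition controlled_on X A rho omega (D : set X) (f : X -> A) : Prop :=
  forall x1 x2, D x1 -> D x2 ->
    rho (mdist x1 x2) <= mdist (f x1) (f x2) <= omega (mdist x1 x2).

(** The target and the controls are common to all indices and all bounded sets;
only the map depends on the set. *)
Definition bounded_sets_embed (I : Type) (X : I -> metricType R) A rho omega :=
  forall i (r : R) (D : set (X i)), D !=set0 ->
    (forall x y, D x -> D y -> mdist x y <= r) ->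
    exists f : X i -> A, controlled_on rho omega D f.

(** What a fibred coarse embedding provides in the end: uniform embeddings of
bounded sets, outside finitely many components that depend on the diameter.
Speaking of finite sets of indices removes the enumeration. *)
Definition far_bounded_sets_embed (I : eqType) (X : I -> metricType R) A
    rho omega :=
  forall r : R, exists J : seq I, forall i, i \notin J ->
    forall D : set (X i), D !=set0 ->
      (forall x y, D x -> D y -> mdist x y <= r) ->
      exists f : X i -> A, controlled_on rho omega D f.

(** Any two points lie in almost all of the balls, so the controls hold for
almost all [k] and pass to the limit. The bound [b] makes the images of [x0],
and through [omega] those of all other points, bounded sequences. *)
Lemma ultralimit_controlled X A (U : ultrafilter) (y : nat -> A) rho omega
    (x0 : X) (f : nat -> X -> A) (b : R) :
  (forall k, mdist (f k x0) (y k) <= b) ->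
  (forall k, controlled_on rho omega [set x | mdist x0 x <= k%:R] (f k)) ->
  exists F : X -> ultralimit U y, controlled_on rho omega setT F.
Proof.
(* Outside the k-th ball f k is unknown and is replaced by its value at x0. *)
move=> fy fC; pose z x k := if mdist x0 x <= k%:R then f k x else f k x0.
have zb x : exists c, forall k, mdist (z x k) (y k) <= c.
  exists (`|omega (mdist x0 x)| + b) => k; rewrite /z; case: ifP => xk; last first.
    by rewrite (le_trans (fy k))// lerDr.
  rewrite (le_trans (metric_triangle _ (f k x0) _))// lerD//.
  rewrite metric_sym (le_trans _ (ler_norm _))//.
  have x0k : mdist x0 x0 <= k%:R by rewrite mdistxx ler0n.
  by have /andP[_] := fC k x0 x x0k xk.
exists (fun x => ultralimit_class U (BoundedSeq (zb x))) => x1 x2 _ _.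
have near_f : \forall k \near ultra_sets U,
    rho (mdist x1 x2) <= mdist (z x1 k) (z x2 k) <= omega (mdist x1 x2).
  have := ultrafilter_tail U (Num.truncn (Num.max (mdist x0 x1) (mdist x0 x2))).+1.
  apply: filterS => k kN.
  have : Num.max (mdist x0 x1) (mdist x0 x2) <= k%:R.
    by apply/ltW/(lt_le_trans (truncnS_gt _)); rewrite ler_nat.
  rewrite ge_max => /andP[x1k x2k]; rewrite /z x1k x2k.
  exact: fC.
rewrite mdist_ultralimit; apply/andP; split.
  by apply: ultra_dist_ge; move: near_f; apply: filterS => k /andP[].
by apply: ultra_dist_le; move: near_f; apply: filterS => k /andP[].
Qed.

Lemma finite_metric_bounded X :
  finite_set [set: X] -> exists r : R, forall x y : X, mdist x y <= r.
Proof.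
move=> /finite_seqP[s sX].
exists (\sum_(x <- s) \sum_(y <- s) mdist x y) => x y.
have xs v : v \in s by have : [set: X] v by []; rewrite sX.
rewrite (big_rem x)//= (big_rem y)//= -!addrA lerDl addr_ge0//.
  by apply: sumr_ge0 => v _; exact: mdist_ge0.
by apply: sumr_ge0 => u _; apply: sumr_ge0 => v _; exact: mdist_ge0.
Qed.

(** The controls constrain only pairs at finite distance, that is, in one
component, so maps into one target with common controls can be put together. *)
Lemma coarse_embedding_single_target (M : spaceclass (metricType R)) (I : eqType)
    (X : I -> metricType R) A rho omega :
  control_function rho -> control_function omega -> M A ->
  (forall i, exists f : X i -> A, controlled_on rho omega setT f) ->
  coarse_embedding_into M (@du_dist R I X).
Proof.
move=> crho comega MA /choice_forall[f fC]; exists A; split=> //.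
exists (fun x => f (tag x) (tagged x)), rho, omega; split=> //.
case=> i x [j y]; rewrite /du_dist /=; case: eqP => [ij|_]; last by rewrite ltxx.
by subst j; rewrite tagged_asE => _; exact: fC.
Qed.

Lemma bounded_sets_embed_balls (I : Type) (X : I -> metricType R) A rho omega
    (x0 : forall i, X i) :
  bounded_sets_embed X A rho omega ->
  exists f : forall i, nat -> X i -> A,
    forall i k, controlled_on rho omega [set x | mdist (x0 i) x <= k%:R] (f i k).
Proof.
move=> XA.
have h (ik : I * nat) : exists f : X ik.1 -> A,
    controlled_on rho omega [set x | mdist (x0 ik.1) x <= ik.2%:R] f.
  apply: (XA ik.1 (ik.2%:R + ik.2%:R)); first by exists (x0 ik.1); rewrite /= mdistxx.
  move=> x y /= xk yk; rewrite (le_trans (metric_triangle _ (x0 ik.1) _))// lerD//.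
  by rewrite metric_sym.
have [f fC] := choice_forall h.
by exists (fun i k => f (i, k)) => i k; exact: (fC (i, k)).
Qed.

Section Ultrapower.
Context (M : spaceclass (metricType R)) (I : eqType) (X : I -> metricType R).
Context (A : metricType R) (rho omega : R -> R).
Hypothesis ultraM : subclass (ultrapowers M) M.
Hypothesis MA : M A.
Hypothesis X_nonempty : forall i, inhabited (X i).
Hypothesis crho : control_function rho.
Hypothesis comega : control_function omega.
Hypothesis XA : bounded_sets_embed X A rho omega.

Let ultrapower_in_class U (y : nat -> A) : M (ultralimit U y).
Proof. by apply: ultraM; exists A, U, y; split=> //; exact: isometric_refl. Qed.

(** Taking [f k x0] as base points forces nothing on the position of the
images, but makes the target depend on the component. *)
Lemma componentwise_coarse_embedding : componentwise_coarse_embedding_into M X.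
Proof.
have [x0] := inhabited_forall X_nonempty; have [f fC] := bounded_sets_embed_balls x0 XA.
have [U] := ultrafilter_exists.
exists rho, omega; split=> // i; exists (ultralimit U (fun k => f i k (x0 i))).
split=> //.
have [|F FC] := @ultralimit_controlled _ _ U (fun k => f i k (x0 i)) _ _ (x0 i)
  (f i) 0 _ (fC i); first by move=> k; rewrite mdistxx.
by exists F => x1 x2; exact: FC.
Qed.

(** The isometries that come from coboundedness move all the images of base
points near one point [q], whence all components map to the ultrapower along
the constant sequence [q]. *)
Lemma coarse_embedding_cobounded :
  I -> cobounded A -> coarse_embedding_into M (@du_dist R I X).
Proof.
move=> i0 [b Ab]; have [x0] := inhabited_forall X_nonempty.
have [f fC] := bounded_sets_embed_balls x0 XA.
have [U] := ultrafilter_exists.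
pose q := f i0 0%N (x0 i0).
have [g gP] := choice (fun p => Ab p q).
apply: (@coarse_embedding_single_target _ _ _ (ultralimit U (fun=> q)) rho omega) => // i.
apply: (@ultralimit_controlled _ _ U (fun=> q) _ _ (x0 i)
  (fun k x => g (f i k (x0 i)) (f i k x)) b) => k; first by have [_] := gP (f i k (x0 i)).
move=> x1 x2 x1k x2k; have [[g_iso _] _] := gP (f i k (x0 i)).
by rewrite g_iso; exact: fC.
Qed.

Lemma coarse_embedding_finite :
  (forall i, finite_set [set: X i]) -> coarse_embedding_into M (@du_dist R I X).
Proof.
move=> Xfin; apply: (coarse_embedding_single_target crho comega MA) => i.
have [r Xr] := finite_metric_bounded (Xfin i).
by apply: XA => [|x y _ _]; [have [x] := X_nonempty i; exists x | exact: Xr].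
Qed.

End Ultrapower.

(** * Fibred coarse embeddings of products *)

(** A trivialization of a set identifies the section over it with a map to the
model space. *)
Lemma fibred_far_bounded_sets_embed (S : Type) (u : S -> metricType R)
    (iso : forall V W, (u V -> u W) -> Prop) (M : spaceclass S) (I : eqType)
    (X : I -> metricType R) :
  fibred_coarse_embedding_with iso M X ->
  exists V, M V /\ exists rho omega,
    [/\ control_function rho, control_function omega &
      far_bounded_sets_embed X (u V) rho omega].
Proof.
case=> _ [enum [_ [V [MV [rho [omega [crho comega [F [s [_ Fs]]]]]]]]]].
exists V; split=> //; exists rho, omega; split=> // r.
have [r0|r0] := leP 0 r; last first.
  exists [::] => i _ D [x Dx] Dr; have := Dr x x Dx Dx.
  by rewrite mdistxx leNgt r0.
have [l [_ [t [tC _]]]] := Fs r r0.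
exists [seq enum k | k <- iota 0 l] => i iJ D [x0 Dx0] Dr.
pose C := [set existT (fun i => X i) i x | x in D].
have [] := tC C.
  split; first by exists (existT (fun i => X i) i x0), x0.
    move=> _ k [x Dx <-] kl /=; apply: contraNneq iJ => ->.
    by apply: map_f; rewrite mem_iota.
  apply: ge_ereal_sup => _ [[_ _] [/= [x Dx <-] [y Dy <-]] <-].
  by rewrite /du_dist /= eqxx tagged_asE lee_fin Dr.
pose emb x := existT (fun i => X i) i x.
move=> _ tD; exists (fun x => t C (emb x) (s (emb x))) => x1 x2 Dx1 Dx2.
have := tD (emb x1) (emb x2).
rewrite /du_dist /= eqxx tagged_asE /=; apply.
  by exists x1.
by exists x2.
Qed.

(** Each [X i] sits isometrically in infinitely many of the [Y k], hence in one
that avoids any given finite set of indices. *)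
Lemma slices_embed (K : eqType) (Y : K -> metricType R) (I : Type)
    (X : I -> metricType R) (A : metricType R) rho omega
    (phi : I -> nat -> K) (e : forall i n, X i -> Y (phi i n)) :
  (forall i, injective (phi i)) ->
  (forall i n x y, mdist (e i n x) (e i n y) = mdist x y) ->
  far_bounded_sets_embed Y A rho omega ->
  bounded_sets_embed X A rho omega.
Proof.
move=> phi_inj e_iso YA i r D D0 Dr; have [J JA] := YA r.
have [n nJ] : exists n, phi i n \notin J.
  apply: contrapT => /forallNP allJ.
  have sub : {subset [seq phi i n | n <- iota 0 (size J).+1] <= J}.
    by move=> _ /mapP[n _ ->]; apply/negPn/negP; exact: allJ.
  have := uniq_leq_size _ sub; rewrite (map_inj_uniq (phi_inj i)) iota_uniq.
  by rewrite size_map size_iota ltnn => /(_ isT).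
have [||f fC] := JA _ nJ (e i n @` D).
- by have [x Dx] := D0; exists (e i n x), x.
- by move=> _ _ [x Dx <-] [y Dy <-]; rewrite e_iso; exact: Dr.
exists (f \o e i n) => x1 x2 Dx1 Dx2.
by rewrite -(e_iso _ n) /=; apply: fC; [exists x1|exists x2].
Qed.

End Metric.

Lemma product_slices_embed (R : realType) (S : Type) (u : S -> metricType R)
    (iso : forall A B, (u A -> u B) -> Prop) (M : spaceclass S)
    (X1 X2 : nat -> metricType R) :
  (forall m, inhabited (X1 m)) -> (forall n, inhabited (X2 n)) ->
  let Y := fun mn : nat * nat => l1_metric (X1 mn.1) (X2 mn.2) in
  fibred_coarse_embedding_with iso M Y ->
  exists A, M A /\ exists rho omega,
    [/\ control_function rho, control_function omega,
      bounded_sets_embed X1 (u A) rho omega & bounded_sets_embed X2 (u A) rho omega].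
Proof.
move=> X10 X20 Y /fibred_far_bounded_sets_embed[A [MA [rho [omega [crho comega YA]]]]].
have [p1] := inhabited_forall X10; have [p2] := inhabited_forall X20.
exists A; split=> //; exists rho, omega; split=> //.
- apply: (@slices_embed _ _ Y _ X1 _ rho omega pair (fun m n x => (x, p2 n)) _ _ YA).
    by move=> m n n' [].
  by move=> m n x y; rewrite {1}/mdist /= mdistxx addr0.
- apply: (@slices_embed _ _ Y _ X2 _ rho omega (fun n m => (m, n))
    (fun n m x => (p1 m, x)) _ _ YA).
    by move=> n m m' [].
  by move=> n m x y; rewrite {1}/mdist /= mdistxx add0r.
Qed.

(** Translations act transitively. *)
Lemma norm_metric_cobounded (R : realType) (V : completeNormedModType R) :
  cobounded (norm_metric V).
Proof.
exists 0 => p q; exists (fun x => (x : V) + ((q : V) - p)); split; last first.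
  by rewrite addrC subrK mdistxx.
split=> [x y|z]; first by rewrite /mdist /= opprD addrACA subrr addr0.
by exists ((z : V) - ((q : V) - p)); rewrite subrK.
Qed.

Lemma normed_fibred_coarse_embedding (R : realType)
    (B : spaceclass (completeNormedModType R)) (X1 X2 : nat -> metricType R) :
  (forall m, inhabited (X1 m)) -> (forall n, inhabited (X2 n)) ->
  subclass (ultrapowers (underlying_metric B)) (underlying_metric B) ->
  affine_fibred_coarse_embedding_into B
    (fun mn : nat * nat => l1_metric (X1 mn.1) (X2 mn.2)) ->
  coarse_embedding_into (underlying_metric B) (@du_dist R nat X1) /\
  coarse_embedding_into (underlying_metric B) (@du_dist R nat X2).
Proof.
move=> X10 X20 ultraB.
case/(product_slices_embed X10 X20) => V [BV [rho [omega [crho comega X1V X2V]]]].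
have MV : underlying_metric B (norm_metric V).
  by exists V; split=> //; exact: isometric_refl.
have Vcob := norm_metric_cobounded V.
split.
  exact: (coarse_embedding_cobounded ultraB MV X10 crho comega X1V 0%N Vcob).
exact: (coarse_embedding_cobounded ultraB MV X20 crho comega X2V 0%N Vcob).
Qed.

(** * Ultrapowers of Banach spaces *)

(** The vector space structure is put on the ultralimit itself, so that the
identity is an isometry between the metric and the normed ultrapower. *)
Definition normed_ultrapower (R : realType) (U : ultrafilter)
    (V : completeNormedModType R) : Type :=
  @ultralimit R U (fun=> norm_metric V) (fun=> (0 : V)).

Section NormedUltrapower.
Context (R : realType) (U : ultrafilter) (V : completeNormedModType R).

Local Notation W := (normed_ultrapower U V).

HB.instance Definition _ := Metric.copy W
  (@ultralimit R U (fun=> norm_metric V) (fun=> (0 : V))).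

Local Notation bseq := (@bounded_seq R (fun=> norm_metric V) (fun=> (0 : V))).

(** The terms as vectors, rather than as points of the metric space
[norm_metric V]. *)
Definition sterm (z : bseq) (m : nat) : V := z m.

Lemma sterm_bounded (z : bseq) : exists b, forall m, `|sterm z m| <= b.
Proof.
have [b zb] := bseqP z; exists b => m.
by rewrite -[sterm z m]subr0; exact: zb.
Qed.

Lemma seq_bounded_mdist (z : nat -> V) : (exists b, forall m, `|z m| <= b) ->
  exists b, forall m, mdist (z m : norm_metric V) (0 : V) <= b.
Proof. by case=> b zb; exists b => m; rewrite /mdist /= subr0. Qed.

Definition seq_of_bounded z zb : bseq :=
  @BoundedSeq R (fun=> norm_metric V) (fun=> (0 : V)) z (seq_bounded_mdist zb).

Definition uclass (z : bseq) : W := ultralimit_class U z.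

Definition urepr (p : W) : bseq := projT1 (cid (ultralimit_surj p)).

Lemma ureprK p : uclass (urepr p) = p.
Proof. by rewrite /uclass -(projT2 (cid (ultralimit_surj p))). Qed.

Lemma uclass_mdist_cvg z w :
  `|sterm z m - sterm w m| @[m --> ultra_sets U] --> mdist (uclass z) (uclass w).
Proof. by rewrite mdist_ultralimit; exact: ultra_dist_cvg. Qed.
Arguments uclass_mdist_cvg : clear implicits.

Lemma urepr_cvg0 z :
  `|sterm (urepr (uclass z)) m - sterm z m| @[m --> ultra_sets U] --> (0 : R).
Proof.
have -> : (0 : R) = mdist (uclass (urepr (uclass z))) (uclass z).
  by rewrite ureprK mdistxx.
exact: uclass_mdist_cvg.
Qed.
Arguments urepr_cvg0 : clear implicits.

Lemma uclass_eq z w : (forall m, sterm z m = sterm w m) -> uclass z = uclass w.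
Proof. exact: (@ultralimit_class_eq R U (fun=> norm_metric V) _ z w). Qed.

Lemma uclass_eq0 z w :
  `|sterm z m - sterm w m| @[m --> ultra_sets U] --> (0 : R) -> uclass z = uclass w.
Proof.
move=> h; apply: mdist_positivity.
exact: (ultra_cvg_unique (uclass_mdist_cvg z w) h).
Qed.

Lemma lin_bounded a (z w : bseq) :
  exists b, forall m, `|a *: sterm z m + sterm w m| <= b.
Proof.
have [b zb] := sterm_bounded z; have [c wc] := sterm_bounded w.
exists (`|a| * b + c) => m; rewrite (le_trans (ler_normD _ _))// lerD// normrZ.
by rewrite ler_wpM2l.
Qed.

Lemma zero_bounded : exists b : R, forall m : nat, `|(0 : V)| <= b.
Proof. by exists 0 => _; rewrite normr0. Qed.

Definition lin_seq a z w : bseq := seq_of_bounded (lin_bounded a z w).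
Definition zero_seq : bseq := seq_of_bounded zero_bounded.

Lemma sterm_lin a z w m : sterm (lin_seq a z w) m = a *: sterm z m + sterm w m.
Proof. by []. Qed.

Lemma sterm0 m : sterm zero_seq m = 0. Proof. by []. Qed.

Definition uzero : W := uclass zero_seq.
(** One lifted operation, [a *: p + q], from which sum and scaling are
specialized: that it is well defined has to be shown only once. *)
Definition ulin (a : R) (p q : W) : W := uclass (lin_seq a (urepr p) (urepr q)).

(** Independence of the representatives: replacing them changes [a *: z + w] by
a sequence whose norm is squeezed to [0]. *)
Lemma ulinE a z w : ulin a (uclass z) (uclass w) = uclass (lin_seq a z w).
Proof.
apply: uclass_eq0; rewrite -[0 : R](addr0 0) -[X in X + _](mulr0 `|a|).
pose g m := `|a| * `|sterm (urepr (uclass z)) m - sterm z m|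
  + `|sterm (urepr (uclass w)) m - sterm w m|.
apply: (@squeeze_cvgr _ _ _ _ (cst 0) g).
- apply: filterE => m; rewrite normr_ge0 /g -normrZ.
  by rewrite !sterm_lin opprD addrACA -scalerBr ler_normD.
- by rewrite mulr0 addr0; exact: cvg_cst.
- apply: cvgD; last exact: urepr_cvg0.
  by apply: cvgM; [exact: cvg_cst|exact: urepr_cvg0].
Qed.

Definition uadd p q := ulin 1 p q.
Definition uscale a p := ulin a p uzero.
Definition uopp p := uscale (-1) p.

Lemma uscaleE a z : uscale a (uclass z) = uclass (lin_seq a z zero_seq).
Proof. exact: ulinE. Qed.

Lemma uaddE z w : uadd (uclass z) (uclass w) = uclass (lin_seq 1 z w).
Proof. exact: ulinE. Qed.

Lemma uaddA : associative uadd.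
Proof.
move=> p q r; rewrite -(ureprK p) -(ureprK q) -(ureprK r) /uadd !ulinE.
by apply: uclass_eq => m; rewrite !sterm_lin ?sterm0 !scale1r addrA.
Qed.

Lemma uaddC : commutative uadd.
Proof.
move=> p q; rewrite -(ureprK p) -(ureprK q) /uadd !ulinE.
by apply: uclass_eq => m; rewrite !sterm_lin ?sterm0 !scale1r addrC.
Qed.

Lemma uadd0 : left_id uzero uadd.
Proof.
move=> p; rewrite -(ureprK p) /uadd !ulinE.
by apply: uclass_eq => m; rewrite !sterm_lin ?sterm0 scale1r add0r.
Qed.

Lemma uaddN : left_inverse uzero uopp uadd.
Proof.
move=> p; rewrite -(ureprK p) /uopp uscaleE uaddE.
by apply: uclass_eq => m; rewrite !sterm_lin ?sterm0 scale1r addr0 scaleN1r addNr.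
Qed.

HB.instance Definition _ :=
  GRing.isZmodule.Build W uaddA uaddC uadd0 uaddN.

Lemma uscaleA a b p : uscale a (uscale b p) = uscale (a * b) p.
Proof.
rewrite -(ureprK p) !uscaleE.
by apply: uclass_eq => m; rewrite !sterm_lin ?sterm0 !addr0 scalerA.
Qed.

Lemma uscale1 : left_id 1 uscale.
Proof.
move=> p; rewrite -(ureprK p) !uscaleE.
by apply: uclass_eq => m; rewrite !sterm_lin ?sterm0 !addr0 scale1r.
Qed.

Lemma uscaleDr : right_distributive uscale +%R.
Proof.
move=> a p q; rewrite -(ureprK p) -(ureprK q) /GRing.add /= uaddE !uscaleE uaddE.
by apply: uclass_eq => m; rewrite !sterm_lin ?sterm0 !scale1r !addr0 scalerDr.
Qed.

Lemma uscaleDl p : {morph uscale^~ p : a b / a + b}.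
Proof.
move=> a b; rewrite -(ureprK p) [in RHS]/GRing.add /= !uscaleE uaddE.
by apply: uclass_eq => m; rewrite !sterm_lin ?sterm0 !scale1r !addr0 scalerDl.
Qed.

HB.instance Definition _ :=
  GRing.Zmodule_isLmodule.Build R W uscaleA uscale1 uscaleDr uscaleDl.

Lemma uclass_lin a z w : a *: uclass z + uclass w = uclass (lin_seq a z w).
Proof.
rewrite /GRing.add /= /GRing.scale /= uscaleE uaddE.
by apply: uclass_eq => m; rewrite !sterm_lin ?sterm0 scale1r addr0.
Qed.

Lemma uclass0 : uclass zero_seq = 0. Proof. by []. Qed.

Definition unorm (p : W) : R := mdist p 0.

Lemma unorm_cvg z : `|sterm z m| @[m --> ultra_sets U] --> unorm (uclass z).
Proof.
rewrite /unorm -uclass0; have := uclass_mdist_cvg z zero_seq.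
by under eq_fun do rewrite subr0.
Qed.
Arguments unorm_cvg : clear implicits.

Lemma unormD p q : unorm (p + q) <= unorm p + unorm q.
Proof.
rewrite -(ureprK p) -(ureprK q) -[uclass (urepr p)]scale1r uclass_lin scale1r.
apply: (ler_cvg_to (unorm_cvg _) (cvgD (unorm_cvg _) (unorm_cvg _))).
by apply: filterE => m; rewrite !sterm_lin ?sterm0 scale1r ler_normD.
Qed.

Lemma unormZ a p : unorm (a *: p) = `|a| * unorm p.
Proof.
rewrite -(ureprK p) -[a *: _]addr0 -uclass0 uclass_lin.
have E : (fun m => `|sterm (lin_seq a (urepr p) zero_seq) m|)
    = (fun m => `|a| * `|sterm (urepr p) m|).
  by apply/funext => m; rewrite sterm_lin sterm0 addr0 normrZ.
have := unorm_cvg (lin_seq a (urepr p) zero_seq); rewrite E => /ultra_cvg_unique.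
by apply; apply: cvgM; [exact: cvg_cst|exact: unorm_cvg].
Qed.

Lemma unorm_eq0 p : unorm p = 0 -> p = 0.
Proof. exact: mdist_positivity. Qed.

Lemma unormMn p n : unorm (p *+ n) = unorm p *+ n.
Proof. by rewrite -scaler_nat unormZ normr_nat mulr_natl. Qed.

Lemma unormN p : unorm (- p) = unorm p.
Proof. by rewrite -scaleN1r unormZ normrN1 mul1r. Qed.

HB.instance Definition _ :=
  Num.Zmodule_isNormed.Build R W unormD unorm_eq0 unormMn unormN.

HB.instance Definition _ := isPointed.Build W 0.

Lemma umdist_norm (p q : W) : mdist p q = `|q - p|.
Proof.
rewrite -[RHS]normrN opprB -(ureprK p) -(ureprK q) [_ - _]addrC -scaleN1r uclass_lin.
have E : (fun m => `|sterm (lin_seq (-1) (urepr q) (urepr p)) m|)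
    = (fun m => `|sterm (urepr p) m - sterm (urepr q) m|).
  by apply/funext => m; rewrite sterm_lin scaleN1r addrC.
have := unorm_cvg (lin_seq (-1) (urepr q) (urepr p)); rewrite E => h.
exact: (ultra_cvg_unique (uclass_mdist_cvg _ _) h).
Qed.

HB.instance Definition _ := NormedZmoduleMetric.Build R W umdist_norm.

HB.instance Definition _ :=
  PseudoMetricNormedZmod_Lmodule_isNormedModule.Build R W unormZ.

Lemma ucomplete (F : set_system W) : ProperFilter F -> cauchy F -> cvg F.
Proof.
move=> FF Fc; have [p Fp] := ultralimit_complete FF Fc.
by apply/cvg_ex; exists p.
Qed.

HB.instance Definition _ := Uniform_isComplete.Build W ucomplete.

Lemma ultralimit_normed_ultrapower :
  isometric (@ultralimit R U (fun=> norm_metric V) (fun=> (0 : V)))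
            (norm_metric (normed_ultrapower U V)).
Proof.
exists id; split=> [p q|p]; last by exists p.
by rewrite [LHS]/mdist /= distrC -umdist_norm.
Qed.

End NormedUltrapower.

(** * Ultrapowers of Hilbert spaces *)

(** The axioms of a real inner product that induces the norm, for a bare
function, free of the packaging of bilinear forms. *)
Definition inner_product (R : realType) (V : completeNormedModType R)
    (f : V -> V -> R) : Prop :=
  [/\ forall a x y z, f (a *: x + y) z = a * f x z + f y z,
      forall x y, f x y = f y x & forall x, `|x| ^+ 2 = f x x].

Lemma hilbert_spaceP (R : realType) (V : completeNormedModType R) :
  hilbert_space V <-> exists f : V -> V -> R, inner_product f.
Proof.
split=> [[b bnorm]|[f [flin fsym fnorm]]].
  exists b; split=> // [a x y z|x y]; first exact: linearPl.
  by have := @hermitian_subproof _ _ _ _ b x y; rewrite mul1r.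
have fbil : bilinear_for *%R (@idfun R \; *%R) f.
  split=> [z a x y|x a y z]; first exact: flin.
  by rewrite fsym flin !(fsym x).
have fherm (x y : V) : f x y = (-1) ^+ false * @idfun R (f y x).
  by rewrite mul1r fsym.
have fpos (x : V) : x != 0 -> 0 < f x x.
  by move=> x0; rewrite -fnorm exprn_gt0// normr_gt0.
pose bil := @bilinear_isBilinear.Build R V V R *%R (@idfun R \; *%R) f fbil.
pose herm := @isHermitianSesquilinear.Build R V false (@idfun R) f fherm.
pose pos := @isDotProduct.Build R V f fpos.
pose b : {dot V for @idfun R} := HB.pack f bil herm pos.
by exists b => x; exact: fnorm.
Qed.

Lemma hilbert_space_real (R : realType) : hilbert_space (R^o : completeNormedModType R).
Proof.
apply/hilbert_spaceP; exists (fun x y : R^o => (x : R) * y); split=> [a x y z|x y|x].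
- by rewrite mulrDl mulrA.
- by rewrite mulrC.
- by rewrite real_normK ?num_real// expr2.
Qed.

(** The form that the polarization identity recovers from any norm. It gives a
candidate inner product on the ultrapower without a choice of limits. *)
Definition polar_form (R : realType) (V : completeNormedModType R) (x y : V) : R :=
  (`|x + y| ^+ 2 - `|x - y| ^+ 2) / 4.

Lemma polarization (R : realType) (V : completeNormedModType R)
    (f : V -> V -> R) : inner_product f -> forall x y, f x y = polar_form x y.
Proof.
case=> flin fsym fnorm x y.
have fE a : `|a *: y + x| ^+ 2 = a ^+ 2 * f y y + 2 * a * f x y + f x x.
  by rewrite fnorm flin !(fsym _ (a *: y + x)) !flin (fsym y x); ring.
have := fE 1; have := fE (-1); rewrite /polar_form scaleN1r scale1r !(addrC _ x) => -> ->.
by field.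
Qed.

Section HilbertUltrapower.
Context (R : realType) (U : ultrafilter) (V : completeNormedModType R).
Context (f : V -> V -> R).
Hypothesis fP : inner_product f.

(** By polarization the inner products of the terms are polynomials in norms,
and norms converge along the ultrafilter. *)
Lemma polar_form_cvg z w :
  f (sterm z m) (sterm w m) @[m --> ultra_sets U] -->
    polar_form (uclass U z) (uclass U w).
Proof.
have E : (fun m => f (sterm z m) (sterm w m)) =
    (fun m => (`|sterm (lin_seq 1 z w) m| ^+ 2
      - `|sterm z m - sterm w m| ^+ 2) / 4).
  by apply/funext => m; rewrite (polarization fP) sterm_lin scale1r.
have sumE : uclass U z + uclass U w = uclass U (lin_seq 1 z w).
  by rewrite -uclass_lin scale1r.
have cvg_sqr g (c : R) : g m @[m --> ultra_sets U] --> c ->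
    g m ^+ 2 @[m --> ultra_sets U] --> c ^+ 2.
  by move=> gc; apply: cvgM.
rewrite E /polar_form sumE distrC -umdist_norm; apply: cvgM; last exact: cvg_cst.
apply: cvgB; apply: cvg_sqr; first exact: unorm_cvg.
exact: uclass_mdist_cvg.
Qed.
Arguments polar_form_cvg : clear implicits.

Lemma hilbert_space_ultrapower : hilbert_space (normed_ultrapower U V).
Proof.
have [flin fsym fnorm] := fP.
apply/hilbert_spaceP; exists (@polar_form R _); split=> [a p q r|p q|p].
- rewrite -(ureprK p) -(ureprK q) -(ureprK r) uclass_lin.
  apply: (ultra_cvg_unique (polar_form_cvg _ _)).
  have E :
      (fun m => f (sterm (lin_seq a (urepr p) (urepr q)) m) (sterm (urepr r) m))
    = (fun m => a * f (sterm (urepr p) m) (sterm (urepr r) m)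
               + f (sterm (urepr q) m) (sterm (urepr r) m)).
    by apply/funext => m; rewrite sterm_lin flin.
  rewrite E; apply: cvgD; last exact: polar_form_cvg.
  by apply: cvgM; [exact: cvg_cst|exact: polar_form_cvg].
- by rewrite /polar_form (addrC p) distrC.
- rewrite /polar_form subrr normr0 expr0n subr0 -mulr2n -scaler_nat normrZ.
  by rewrite normr_nat exprMn; field.
Qed.

End HilbertUltrapower.

(** Translating the base point [y m] to [0] in the [m]-th copy of [V] turns an
ultrapower along arbitrary base points into the normed one. *)
Lemma hilbert_ultrapowers (R : realType) :
  subclass (ultrapowers (underlying_metric (@hilbert_space R)))
           (underlying_metric (@hilbert_space R)).
Proof.
move=> N [A [U [y [[V [/hilbert_spaceP[f fP] [g [gd gs]]] NA]]]]].
exists (normed_ultrapower U V); split; first exact: hilbert_space_ultrapower fP.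
apply: (isometric_trans NA).
pose h m (x : A) : norm_metric V := (g x : V) - (g (y m) : V).
have hiso m : isometry_onto (h m).
  split=> [x x'|v].
    by rewrite -gd [LHS]/mdist /= /h opprB addrA subrK.
  by have [x gx] := gs ((v : V) + (g (y m) : V)); exists x; rewrite /h gx addrK.
apply: (isometric_trans (ultralimit_isometric U y hiso)).
have -> : (fun m => h m (y m)) = (fun=> 0 : V).
  by apply/funext => m; rewrite /h subrr.
exact: ultralimit_normed_ultrapower.
Qed.

(** * Both factors of a product *)

Theorem proposition1p8 (R : realType) (Gamma Lambda : nat -> connected_graph)
    (hGamma : uniformly_bounded_degree Gamma)
    (hLambda : uniformly_bounded_degree Lambda) :
  let X1 := fun m => graph_metric R (Gamma m) in
  let X2 := fun n => graph_metric R (Lambda n) in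
  let X1X2 := fun mn : nat * nat =>
    l1_metric (X1 mn.1) (X2 mn.2) in
  (forall M : spaceclass (metricType R),
     nonempty_class M -> subclass (ultrapowers M) M ->
     fibred_coarse_embedding_into M X1X2 ->
     [/\ componentwise_coarse_embedding_into M X1,
         componentwise_coarse_embedding_into M X2,
         mergeable M Gamma -> coarse_embedding_into M (@du_dist R nat X1) &
         mergeable M Lambda -> coarse_embedding_into M (@du_dist R nat X2)]) /\
  (forall B : spaceclass (completeNormedModType R),
     nonempty_class B ->
     subclass (ultrapowers (underlying_metric B)) (underlying_metric B) ->
     affine_fibred_coarse_embedding_into B X1X2 ->
     coarse_embedding_into (underlying_metric B) (@du_dist R nat X1) /\
     coarse_embedding_into (underlying_metric B) (@du_dist R nat X2)) /\
  (let Hilbert := @hilbert_space R in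
   [/\ nonempty_class Hilbert,
       subclass (ultrapowers (underlying_metric Hilbert))
                (underlying_metric Hilbert) &
       affine_fibred_coarse_embedding_into Hilbert X1X2 ->
       coarse_embedding_into (underlying_metric Hilbert) (@du_dist R nat X1) /\
       coarse_embedding_into (underlying_metric Hilbert) (@du_dist R nat X2)]).
Proof.
have X10 m : inhabited (graph_metric R (Gamma m)).
  exact: vertex_nonempty (Gamma m).
have X20 n : inhabited (graph_metric R (Lambda n)).
  exact: vertex_nonempty (Lambda n).
move=> X1 X2 X1X2; split; last split.
- move=> M _ ultraM.
  case/(product_slices_embed X10 X20) => A [MA [rho [omega [crho comega X1A X2A]]]].
  split; [exact: (componentwise_coarse_embedding ultraM MA X10 crho comega X1A)
         |exact: (componentwise_coarse_embedding ultraM MA X20 crho comega X2A)| |].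
  + case=> [Gfin|Mcob].
      exact: (coarse_embedding_finite MA X10 crho comega X1A Gfin).
    exact: (coarse_embedding_cobounded ultraM MA X10 crho comega X1A 0%N (Mcob A MA)).
  + case=> [Lfin|Mcob].
      exact: (coarse_embedding_finite MA X20 crho comega X2A Lfin).
    exact: (coarse_embedding_cobounded ultraM MA X20 crho comega X2A 0%N (Mcob A MA)).
- by move=> B _ ultraB; exact: normed_fibred_coarse_embedding.
- split; first by exists R^o; exact: hilbert_space_real.
    exact: hilbert_ultrapowers.
  by apply: normed_fibred_coarse_embedding => //; exact: hilbert_ultrapowers.
Qed.
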